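(* Let $K$ be a field of characteristic $0$ and let $\mathrm{Sym}(n\times n,K)$ denote the space of symmetric $n\times n$ matrices over $K$. Let $f:\mathbb{Z}\to \mathrm{Sym}(n\times n,K)$ be a map such that $\operatorname{rk}\big(f(x+y)-f(x)-f(y)\big)\le 1$ for all $x,y\in\mathbb{Z}$. Then there exists $A\in \mathrm{Sym}(n\times n,K)$ such that $\operatorname{rk}\big(f(x)-x\cdot A\big)\le 2$ for all $x\in\mathbb{Z}$.
   Context: Such a map $f$ is called a 1-quasihomomorphism (with respect to the rank norm on matrices). *)

(* Defs.v *)
From mathcomp Require Import all_boot all_order all_algebra.

Set Implicit Arguments.
Unset Strict Implicit.
Unset Printing Implicit Defensive.

Import GRing.Theory.
Local Open Scope ring_scope.

(* symmetricmx is the library's (1, id)-hermitian matrix predicate; over a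
   field it is the usual condition M^T = M. *)
Lemma symmetricmxP (K : fieldType) (n : nat) (M : 'M[K]_n) :
  reflect (M^T = M) (M \is symmetricmx).
Proof.
rewrite qualifE /= expr0 scale1r map_mx_id //.
by apply: (iffP eqP) => /esym.
Qed.

(* Main.v *)
Require Import Defs.
From mathcomp Require Import all_boot all_order all_algebra.
From mathcomp Require Import zify ring.
From Stdlib Require Import Classical.

Set Implicit Arguments.
Unset Strict Implicit.
Unset Printing Implicit Defensive.

Import Order.TTheory GRing.Theory Num.Theory.
Local Open Scope ring_scope.

(* Normalize f 1 = 0. If the row spaces of the f x, x > 0, all lie in a space W
   of rank at most 2, there is at most the behaviour at negative x to repair.
   Otherwise there is a first m with f m outside such a W. The rank-one defects
   f m - f x - f (m - x), 0 < x < m, agree modulo W and are not in W, so by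
   symmetry they are one and the same matrix; hence f x + f (m - x) is constant
   and, after subtracting a multiple of x, f is odd with respect to x -> m - x.
   Let F be the m-periodic odd extension of f from 0 < x < m. The error f x - F x
   is within rank 1 of f m (up to sign) and of the defects of F at x. If these
   defects span a plane, the error is within rank 1 of three independent
   symmetric rank-one matrices, so it vanishes. If they only span a line P, then
   F x itself lies in P because the characteristic is 0, and f x is within rank 1
   of P. *)

Ltac mxring := apply/matrixP => ? ?; rewrite !mxE; ring.

(** * Symmetric matrices of rank at most one *)

Section SymmetricRankOne.
Variables (K : fieldType) (n : nat).
Implicit Types (a b d q M P W : 'M[K]_n).

Lemma rank1_cap0 a b : (\rank b <= 1)%N -> ~~ (b <= a)%MS -> (a :&: b)%MS = 0.
Proof.
move=> rb nba; apply/eqP; rewrite -mxrank_eq0 -leqn0 leqNgt; apply/negP => r0.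
move/negP: nba; apply; apply: submx_trans (capmxSl a b).
have /mxrank_leqif_sup/geq_leqif <- := capmxSr a b.
exact: leq_trans rb r0.
Qed.

(** If [C] is the cokernel of [a - b], then [a *m C = b *m C]. By symmetry the transpose of this
    product lies in both row spaces, so it vanishes and [C] kills [a]. *)
Lemma sym_cap0_sub a b :
  a^T = a -> b^T = b -> (a :&: b)%MS = 0 -> (a <= (a - b)%R)%MS.
Proof.
move=> sa sb ab0; rewrite submxE; set C := cokermx _.
have abC : a *m C = b *m C.
  by apply/eqP; rewrite -subr_eq0 -mulmxBl mulmx_coker.
have : (C^T *m a <= a :&: b)%MS.
  rewrite sub_capmx submxMl -{1}sa -trmx_mul abC trmx_mul sb; exact: submxMl.
rewrite ab0 submx0 => /eqP Ca0.
by rewrite -[a *m C]trmxK trmx_mul sa Ca0 trmx0.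
Qed.

(** If [e] were not in the line of [d], [sym_cap0_sub] would put [d] inside [d - e], hence inside
    [W]. So [d - e] lies in that line and in [W], which meet in 0. *)
Lemma sym_rank1_eq_mod W d e :
  d^T = d -> e^T = e -> (\rank d <= 1)%N -> (\rank e <= 1)%N ->
  ~~ (d <= W)%MS -> ((d - e)%R <= W)%MS -> d = e.
Proof.
move=> sd se rd re ndW deW.
have [ed | ned] := boolP (e <= d)%MS; last first.
  case/negP: ndW; apply: submx_trans deW.
  exact/sym_cap0_sub/rank1_cap0.
apply/eqP; rewrite -subr_eq0 -submx0 -(rank1_cap0 rd ndW) sub_capmx deW /=.
by rewrite addmx_sub // eqmx_opp.
Qed.

(** By [sym_cap0_sub] the plane [a + b] lies in the sum of the row spaces of [q - a] and [q - b].
    That sum has rank at most 2, so it is this plane. *)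
Lemma near_two a b q :
  a^T = a -> b^T = b -> (\rank a <= 1)%N -> (\rank b <= 1)%N ->
  a != 0 -> ~~ (b <= a)%MS ->
  (\rank (q - a)%R <= 1)%N -> (\rank (q - b)%R <= 1)%N -> (q <= a + b)%MS.
Proof.
move=> sa sb ra rb a0 nba rqa rqb.
have ab0 := rank1_cap0 rb nba.
have b0 : b != 0 by apply: contraNneq nba => ->; exact: sub0mx.
have subab : (a + b <= (q - a)%R + (q - b)%R)%MS.
  have ab : ((a - b)%R <= (q - a)%R + (q - b)%R)%MS.
    have -> : a - b = (q - b) - (q - a) by rewrite opprB [RHS]addrC addrA subrK.
    by rewrite addmx_sub ?eqmx_opp ?addsmxSl ?addsmxSr.
  rewrite addsmx_sub (submx_trans _ ab) ?sym_cap0_sub //=.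
  apply: submx_trans ab; rewrite -opprB eqmx_opp.
  by apply: sym_cap0_sub => //; rewrite capmxC.
have /mxrank_leqif_sup/geq_leqif := subab.
have -> : (\rank ((q - a)%R + (q - b)%R)%MS <= \rank (a + b)%MS)%N.
  apply: (@leq_trans 2).
    by apply: leq_trans (mxrank_adds_leqif _ _) _; exact: leq_add rqa rqb.
  by rewrite mxrank_disjoint_sum // -[2%N]/(1 + 1)%N leq_add // lt0n mxrank_eq0.
move=> /esym/(submx_trans (addsmxSl _ _)) qab.
by rewrite -[q](subrK a) addmx_sub ?addsmxSl.
Qed.

(** [near_two] puts [q] in [W], and in [c + d] for [c] either of [a], [b]. By the modular law
    [c + d] meets [W] in [c], so [q] lies in two independent lines. *)
Lemma near_three W a b d q :
  a^T = a -> b^T = b -> d^T = d ->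
  (\rank a <= 1)%N -> (\rank b <= 1)%N -> (\rank d <= 1)%N ->
  a != 0 -> ~~ (b <= a)%MS -> (a <= W)%MS -> (b <= W)%MS -> ~~ (d <= W)%MS ->
  (\rank (q - a)%R <= 1)%N -> (\rank (q - b)%R <= 1)%N -> (\rank (q - d)%R <= 1)%N ->
  q = 0.
Proof.
move=> sa sb sd ra rb rd a0 nba aW bW ndW qa qb qd.
have b0 : b != 0 by apply: contraNneq nba => ->; exact: sub0mx.
have qW : (q <= W)%MS.
  by apply: submx_trans (near_two sa sb ra rb a0 nba qa qb) _; rewrite addsmx_sub aW.
have sub c : c^T = c -> (\rank c <= 1)%N -> c != 0 -> (c <= W)%MS ->
    (\rank (q - c)%R <= 1)%N -> (q <= c)%MS.
  move=> sc rc c0 cW qc.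
  have ndc : ~~ (d <= c)%MS by apply: contra ndW => /submx_trans; apply.
  have qcd := near_two sc sd rc rd c0 ndc qc qd.
  have : (q <= (c + d) :&: W)%MS by rewrite sub_capmx qcd.
  by rewrite -(matrix_modl _ cW) capmxC (rank1_cap0 rd ndW) addsmx0.
apply/eqP; rewrite -submx0 -(rank1_cap0 rb nba) sub_capmx.
by rewrite !sub.
Qed.

End SymmetricRankOne.

Lemma line_or_pair (K : fieldType) (n : nat) (T : Type) (G : T -> 'M[K]_n) :
  (forall y, (\rank (G y) <= 1)%N) ->
  (exists2 P : 'M[K]_n, (\rank P <= 1)%N & forall y, (G y <= P)%MS) \/
  (exists y z, G y != 0 /\ ~~ (G z <= G y)%MS).
Proof.
move=> rG; case: (classic (exists y, G y != 0)) => [[y y0] | G0]; last first.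
  left; exists 0; rewrite ?mxrank0 // => y; rewrite submx0.
  by apply/negPn/negP => y0; apply: G0; exists y.
case: (classic (exists z, ~~ (G z <= G y)%MS)) => [[z zy] | Gy].
  by right; exists y, z.
left; exists (G y) => // z.
by apply/negPn/negP => zy; apply: Gy; exists z.
Qed.

(** * Quasihomomorphisms and their defects *)

Section QuasiHom.
Variables (K : fieldType) (charK : [pchar K] =i pred0) (n : nat).
Implicit Types (f h F : int -> 'M[K]_n) (x y z k m : int) (A P W d : 'M[K]_n).

Definition defect f x y : 'M[K]_n := f (x + y) - f x - f y.

Definition sym_quasihom f :=
  (forall x, (f x)^T = f x) /\ (forall x y, (\rank (defect f x y) <= 1)%N).

(** The exceptional points: no two independent defects at [x] are available for [near_three]. *)
Definition degenerate f x :=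
  exists2 P : 'M[K]_n, (\rank P <= 1)%N & forall y, (defect f x y <= P)%MS.

Lemma defectC f x y : defect f x y = defect f y x.
Proof. by rewrite /defect (addrC x) addrAC. Qed.

Lemma defect_cocycle f x y z :
  defect f (x + y) z = defect f x (y + z) + defect f y z - defect f x y.
Proof. by rewrite /defect -(addrA x y z); mxring. Qed.

Lemma defect_sym f x y : sym_quasihom f -> (defect f x y)^T = defect f x y.
Proof. by case=> sf _; rewrite /defect !linearB /= !sf. Qed.

Lemma defect_sub_linear f A x y :
  defect (fun x => f x - x%:~R *: A) x y = defect f x y.
Proof. by rewrite /defect intrD; mxring. Qed.

Lemma sym_quasihom_sub_linear f A :
  A^T = A -> sym_quasihom f -> sym_quasihom (fun x => f x - x%:~R *: A).
Proof.
move=> sA [sf rf]; split=> [x | x y]; last by rewrite defect_sub_linear.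
by rewrite linearB linearZ /= sf sA.
Qed.

Lemma intr_char0_eq0 m : (m%:~R == 0 :> K) = (m == 0).
Proof.
have natK (k : nat) : (k%:R == 0 :> K) = (k == 0%N) by move/pcharf0P: charK => ->.
by case: m => k; rewrite ?NegzE ?mulrNz ?oppr_eq0 -pmulrn natK.
Qed.

Lemma int_mod_rep m x : 0 < m -> exists r k, x = r + k * m /\ 0 <= r < m.
Proof.
move=> m0; exists (x %% m)%Z, (x %/ m)%Z; split; first by rewrite addrC -divz_eq.
lia.
Qed.

(** * Defects and values of periodic maps *)

Section Periodic.
Variables (F : int -> 'M[K]_n) (m : int).
Hypotheses (m_gt0 : 0 < m) (Fper : forall x k, F (x + k * m) = F x).

Lemma defect_periodl x y k : defect F (x + k * m) y = defect F x y.
Proof. by rewrite /defect (addrAC x) !Fper. Qed.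

Lemma defect_periodr x y k : defect F x (y + k * m) = defect F x y.
Proof. by rewrite defectC defect_periodl defectC. Qed.

(* Telescoping along the multiples of x gives F (m x) = m F x modulo P, and
   F ((m + 1) x) = F x. *)
Lemma periodic_value_sub P x : (forall y, (defect F x y <= P)%MS) -> (F x <= P)%MS.
Proof.
move=> xP.
have mult (k : nat) : (F (x + k%:Z * x) - (k%:Z + 1)%:~R *: F x <= P)%MS.
  elim: k => [|k IHk]; first by rewrite mul0r !addr0 scale1r subrr sub0mx.
  have -> : F (x + k.+1%:Z * x) - (k.+1%:Z + 1)%:~R *: F x =
     defect F x (x + k%:Z * x) + (F (x + k%:Z * x) - (k%:Z + 1)%:~R *: F x).
    have -> : x + k.+1%:Z * x = x + (x + k%:Z * x) by lia.
    have -> : (k.+1%:Z + 1)%:~R = 1 + (k%:Z + 1)%:~R :> K by rewrite intS; ring.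
    by rewrite /defect; mxring.
  by rewrite addmx_sub.
have := mult `|m|%N; rewrite gez0_abs ?(mulrC m) ?Fper; last by lia.
have -> : F x - (m + 1)%:~R *: F x = - m%:~R *: F x by rewrite intrD; mxring.
by rewrite eqmx_scale // oppr_eq0 intr_char0_eq0; lia.
Qed.

End Periodic.

(** Shifting [y] by a large multiple of [m] makes [y] and [x + y] positive, so [h x - F x] is within
    rank one of every defect of [F] at [x]. If these span only a line, it contains [F x], and [h x]
    is within rank one of it; otherwise [near_two] applies inside [W]. *)
Lemma half_line_rank2 h F m W :
  sym_quasihom h -> 0 < m -> (forall x k, F (x + k * m) = F x) ->
  (forall x, 0 < x -> h x = F x) -> (forall x, (F x <= W)%MS) ->
  (\rank W <= 2)%N -> forall x, (\rank (h x) <= 2)%N.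
Proof.
move=> qh m0 Fper hF FW rW x.
have big y z : exists k, 0 < y + k * m /\ 0 < z + k * m.
  by exists (`|y| + `|z| + 1); nia.
have rF y z : (\rank (defect F y z) <= 1)%N.
  have [k [yk zk]] := big y z.
  have := qh.2 (y + k * m) (z + k * m); rewrite /defect.
  by rewrite !hF //; [rewrite (addrACA y) -mulrDl !Fper | lia].
have sF y : (F y)^T = F y.
  by have [k [yk _]] := big y y; rewrite -(Fper y k) -hF // qh.1.
have qF : sym_quasihom F by [].
have near y : (\rank (h x - F x - defect F x y)%R <= 1)%N.
  have [k [xyk yk]] := big (x + y) y.
  have := qh.2 x (y + k * m); rewrite /defect (addrA x) (hF (x + y + _)) // (hF (y + _)) // !Fper.
  by rewrite -mxrank_opp; congr (\rank _ <= 1)%N; mxring.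
have FWd y : (defect F x y <= W)%MS by rewrite /defect !addmx_sub ?eqmx_opp.
case: (line_or_pair (rF x)) => [[P rP xP] | [y [z [y0 zy]]]].
  have FP := periodic_value_sub m0 Fper xP.
  have -> : h x = (h x - F x - defect F x 0) + (defect F x 0 + F x) by mxring.
  apply: leq_trans (mxrank_add _ _) _; rewrite -[2%N]/(1 + 1)%N leq_add //.
  by apply: leq_trans rP; apply: mxrankS; rewrite addmx_sub.
apply: leq_trans rW; apply: mxrankS; rewrite -[h x](subrK (F x)) addmx_sub //.
apply: submx_trans (near_two _ _ (rF x y) (rF x z) y0 zy (near y) (near z)) _.
- exact: defect_sym.
- exact: defect_sym.
by rewrite addsmx_sub !FWd.
Qed.

(** * The odd periodic extension [F] after the first exit from [W] *)

Section Exit.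
Variables (h F : int -> 'M[K]_n) (m : int) (W : 'M[K]_n).
Hypotheses (qh : sym_quasihom h) (m_gt0 : 0 < m)
  (Fper : forall x k, F (x + k * m) = F x) (F0 : F 0 = 0)
  (Fodd : forall x, F (- x) = - F x)
  (hF : forall x, 0 < x < m -> h x = F x) (FW : forall x, (F x <= W)%MS)
  (hm : (\rank (h m) <= 1)%N) (hmW : ~~ (h m <= W)%MS)
  (rW : (\rank W <= 2)%N) (F1 : ~ degenerate F 1).

Lemma extension_sym x : (F x)^T = F x.
Proof.
have [r [k [-> rm]]] := int_mod_rep x m_gt0; rewrite Fper.
have [->|r0] := eqVneq r 0; first by rewrite F0 trmx0.
by rewrite -hF ?qh.1 //; lia.
Qed.

Lemma extension_defect_rank x y : (\rank (defect F x y) <= 1)%N.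
Proof.
have [r [k [-> rm]]] := int_mod_rep x m_gt0.
have [s [l [-> sm]]] := int_mod_rep y m_gt0.
rewrite defect_periodl ?defect_periodr //.
have [->|r0] := eqVneq r 0.
  by rewrite /defect F0 add0r subr0 subrr mxrank0.
have [->|s0] := eqVneq s 0.
  by rewrite /defect F0 addr0 subrr sub0r oppr0 mxrank0.
have [rs|rs|rs] := ltgtP (r + s) m.
- by rewrite /defect -!hF ?qh.2 //; lia.
(* Reflecting both residues brings their sum below [m]; oddness turns the resulting defect of [h]
   into the opposite of the wanted one. *)
- have := qh.2 (m - r) (m - s); rewrite /defect !hF; try lia.
  rewrite -mxrank_opp; congr (\rank _ <= 1)%N.
  have -> : m - r + (m - s) = - (r + s) + (2 * m) by ring.
  have -> : m - r = - r + 1 * m by ring.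
  have -> : m - s = - s + 1 * m by ring.
  by rewrite !Fper !Fodd; mxring.
have -> : s = - r + 1 * m by lia.
by rewrite /defect addrA addrN !Fper Fodd F0 sub0r opprK addNr mxrank0.
Qed.

Lemma extension_quasihom : sym_quasihom F.
Proof. by split; [exact: extension_sym | exact: extension_defect_rank]. Qed.

Lemma extension_defectW x y : (defect F x y <= W)%MS.
Proof. by rewrite /defect !addmx_sub ?eqmx_opp. Qed.

Lemma degenerate_value x P : (forall y, (defect F x y <= P)%MS) -> (F x <= P)%MS.
Proof. exact: periodic_value_sub m_gt0 Fper _ _. Qed.

Lemma degenerate_period x k : degenerate F (x + k * m) -> degenerate F x.
Proof. by case=> P rP xP; exists P => // y; rewrite -(defect_periodl Fper _ _ k). Qed.

Lemma degenerate_multiple k : degenerate F (k * m).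
Proof.
exists 0; rewrite ?mxrank0 // => y.
by rewrite -[k * m]add0r defect_periodl // /defect add0r F0 subr0 subrr.
Qed.

(** The nonzero [defect F x y] lies in the lines of both [x] and [y], so the two coincide, and the
    cocycle identity keeps every defect at [x + y] in this line. *)
Lemma degenerate_add x y : degenerate F x -> degenerate F y ->
  defect F x y != 0 -> degenerate F (x + y).
Proof.
case=> P rP xP [Q rQ yQ] xy0; exists (defect F x y); first exact: extension_defect_rank.
have sub (R : 'M[K]_n) : (\rank R <= 1)%N -> (defect F x y <= R)%MS -> (R <= defect F x y)%MS.
  move=> rR xyR; have /mxrank_leqif_sup/geq_leqif <- := xyR.
  by apply: leq_trans rR _; rewrite lt0n mxrank_eq0.
move=> z; rewrite defect_cocycle.
apply: addmx_sub; last by rewrite eqmx_opp.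
apply: addmx_sub; first exact: submx_trans (xP _) (sub P rP (xP y)).
by apply: submx_trans (yQ _) (sub Q rQ _); rewrite defectC.
Qed.

(* Since [defect F x (- x - y) = defect F x y], a degenerate x + y can be traded
   for - y, and x + y and - y are not both degenerate if that defect is nonzero. *)
Lemma nondegenerate_agree x d :
  ~ degenerate F x -> d^T = d -> (\rank d <= 1)%N -> ~~ (d <= W)%MS ->
  (\rank (h x - F x - d)%R <= 1)%N ->
  (forall y, 0 < y < m -> ~ degenerate F (x + y) ->
     (\rank (h x - F x - defect F x y)%R <= 1)%N) ->
  h x = F x.
Proof.
move=> ndx sd rd ndW near_d near.
have near0 y : ~ degenerate F (x + y) -> defect F x y != 0 ->
    (\rank (h x - F x - defect F x y)%R <= 1)%N.
  have [r [k [-> rm]]] := int_mod_rep y m_gt0; rewrite defect_periodr // addrA.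
  have [->|r0 ndxr _] := eqVneq r 0.
    by rewrite /defect addr0 F0 subrr oppr0 addr0 eqxx.
  apply: near; first by lia.
  by move=> dxr; apply: ndxr; apply: (@degenerate_period _ (- k)); rewrite mulNr addrK.
have near_all y : defect F x y != 0 ->
    (\rank (h x - F x - defect F x y)%R <= 1)%N.
  move=> xy0; case: (classic (degenerate F (x + y))) => [dxy | ndxy]; last exact: near0.
  have E : defect F x y = defect F x (- x - y).
    by rewrite /defect addrA addrN add0r -opprD !Fodd; mxring.
  rewrite E; apply: near0; last by rewrite -E.
  rewrite addrA addrN add0r => dy; apply: ndx.
  rewrite -[x](addrK y); apply: degenerate_add => //.
  apply: contraNneq xy0; rewrite /defect addrK Fodd => E0.
  by rewrite -oppr_eq0 -E0; apply/eqP; mxring.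
case: (line_or_pair (extension_defect_rank x)) => [//| [y [z [y0 zy]]]].
have z0 : defect F x z != 0 by apply: contraNneq zy => ->; exact: sub0mx.
apply/eqP; rewrite -subr_eq0; apply/eqP.
by apply: (near_three (W := W) (a := defect F x y) (b := defect F x z) (d := d));
  rewrite ?extension_defect_rank ?extension_defectW ?near_all // (defect_sym _ _ extension_quasihom).
Qed.

(** Strong induction. For [N > m], the splitting [m + (N - m)] compares [h N - F N] with [h m], and
    [(m - y) + (N + y - m)] compares it with [defect F N y]; the other arguments lie below [N]. *)
Lemma agree_pos (N : nat) : ~ degenerate F N -> 0 < N%:Z -> h N = F N.
Proof.
elim/ltn_ind: N => N IH ndN N0.
have [Nm|Nm|NE] := ltgtP N%:Z m; last first.
- by case: ndN; rewrite NE -[m]mul1r; exact: degenerate_multiple.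
- have IHz x : 0 < x < N%:Z -> ~ degenerate F x -> h x = F x.
    by case: x => x xN ndx; [apply: IH => //; lia | lia].
  apply: (nondegenerate_agree ndN (qh.1 m) hm hmW).
    have := qh.2 m (N%:Z - m); rewrite /defect (addrC m) subrK (IHz (_ - m)); last 2 first.
    + by lia.
    + by move=> dNm; apply: ndN; apply: (@degenerate_period _ (- 1)); rewrite mulN1r.
    have -> : N%:Z - m = N%:Z + (- 1) * m by ring.
    by rewrite Fper addrAC.
  move=> y ym ndNy.
  have := qh.2 (m - y) (N%:Z + y - m); rewrite /defect (hF (x := m - y)); last by lia.
  rewrite (IHz (_ + _ - m)); last 2 first.
  + by lia.
  + by move=> dN; apply: ndNy; apply: (@degenerate_period _ (- 1)); rewrite mulN1r.
  have -> : m - y + (N%:Z + y - m) = N%:Z by ring.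
  have -> : m - y = - y + 1 * m by ring.
  have -> : N%:Z + y - m = N%:Z + y + (- 1) * m by ring.
  by rewrite !Fper Fodd; congr (\rank _ <= 1)%N; mxring.
by apply: hF; lia.
Qed.

(** Descending induction: adding [m], or [y] with [0 < y < m], leads to larger arguments. Here the
    matrix outside [W] is [- h m]. *)
Lemma agree_neg (N : nat) : ~ degenerate F (- N%:Z) -> h (- N%:Z) = F (- N%:Z).
Proof.
elim/ltn_ind: N => N IH ndN.
have IHz x : - N%:Z < x -> ~ degenerate F x -> h x = F x.
  case: (ltP 0 x) => [x0 _ | x0 xN].
    have -> : x = `|x|%N by lia.
    by move=> ndx; apply: agree_pos => //; lia.
  have -> : x = - `|x|%N%:Z by lia.
  by apply: IH; lia.
apply: (nondegenerate_agree ndN (d := - h m)); rewrite ?mxrank_opp ?eqmx_opp //.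
- by rewrite linearN /= qh.1.
- have := qh.2 (- N%:Z) m; rewrite /defect (IHz (_ + m)); last 2 first.
  + by lia.
  + by move=> dN; apply: ndN; apply: (@degenerate_period _ 1); rewrite mul1r.
  have -> : F (- N%:Z + m) = F (- N%:Z) by rewrite -{1}[m]mul1r Fper.
  by rewrite -mxrank_opp; congr (\rank _ <= 1)%N; mxring.
move=> y ym ndNy; have := qh.2 (- N%:Z) y; rewrite /defect (hF ym) (IHz (_ + y)) //; last by lia.
by rewrite -mxrank_opp; congr (\rank _ <= 1)%N; mxring.
Qed.

Lemma agree_nondegenerate x : ~ degenerate F x -> h x = F x.
Proof.
case: (ltP 0 x) => x0.
  have -> : x = `|x|%N by lia.
  by move=> ndx; apply: agree_pos => //; lia.
have -> : x = - `|x|%N%:Z by lia.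
exact: agree_neg.
Qed.

(** For degenerate [x], let [r] be the residue of [x - 1]. Then [x - r] is congruent to 1, hence
    nondegenerate, and the splitting [(x - r) + r] puts [h x] within rank one of [F 1 + F (x - 1)].
    The latter equals [F x + defect F x (- 1)], which lies in the line [P]. *)
Lemma exit_rank2 x : (\rank (h x) <= 2)%N.
Proof.
case: (classic (degenerate F x)) => [dx | /agree_nondegenerate ->]; last first.
  exact: leq_trans (mxrankS (FW x)) rW.
have [r [k [xE rm]]] := int_mod_rep (x - 1) m_gt0.
have r0 : r != 0.
  apply/eqP => r0; apply: F1; apply: (@degenerate_period _ k).
  by have -> : 1 + k * m = x by lia.
have h1 : h (x - r) = F 1.
  have -> : x - r = 1 + k * m by lia.
  by rewrite agree_nondegenerate ?Fper // => /degenerate_period.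
have hr : h r = F (x - 1) by rewrite xE Fper hF //; lia.
have := qh.2 (x - r) r; rewrite /defect subrK h1 hr => near.
case: dx => P rP xP; have FP := degenerate_value xP.
have -> : h x = (h x - F 1 - F (x - 1)) + (F x + defect F x (- 1)).
  by rewrite /defect Fodd; mxring.
apply: leq_trans (mxrank_add _ _) _; rewrite -[2%N]/(1 + 1)%N leq_add //.
by apply: leq_trans rP; apply: mxrankS; rewrite addmx_sub.
Qed.

End Exit.

(** * Choice of the linear part [A] in the two cases *)

Lemma scale_int_inv m A : m != 0 -> m%:~R *: (m%:~R^-1 *: A) = A.
Proof. by move=> m0; rewrite scalerA divff ?scale1r // intr_char0_eq0. Qed.

Lemma half_line_approx f W :
  sym_quasihom f -> (forall x, 0 < x -> (f x <= W)%MS) -> (\rank W <= 2)%N ->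
  exists A, A^T = A /\ forall x, (\rank (f x - x%:~R *: A)%R <= 2)%N.
Proof.
move=> qf fW rW.
case: (classic (exists2 k, 0 < k & ~~ (f (- k) <= W)%MS)) => [[k k0 nkW] | negW];
  last first.
  exists 0; split=> [|x]; rewrite ?trmx0 // scaler0 subr0.
  have [x0|x0|->] := ltgtP x 0.
  - apply: leq_trans rW; apply: mxrankS; apply/negPn/negP => xW.
    by apply: negW; exists (- x); rewrite ?opprK //; lia.
  - by apply: leq_trans rW; apply: mxrankS; exact: fW.
  have := qf.2 0 0; rewrite /defect addr0 subrr sub0r mxrank_opp => r0.
  exact: leq_trans r0 _.
pose e x := defect f (x + k) (- k).
have eE x : e x = f x - f (x + k) - f (- k) by rewrite /e /defect addrK.
have eW x : 0 < x -> ((e x + f (- k))%R <= W)%MS.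
  by move=> x0; rewrite eE subrK addmx_sub ?eqmx_opp ?fW //; lia.
have e1 x : 0 < x -> e x = e 1.
  move=> x0; apply: (sym_rank1_eq_mod (W := W)); rewrite ?defect_sym ?qf.2 //.
    apply: contra nkW => exW; rewrite -[f (- k)](addKr (e x)).
    by rewrite addmx_sub ?eqmx_opp ?eW.
  have -> : e x - e 1 = (e x + f (- k)) - (e 1 + f (- k)) by mxring.
  by rewrite addmx_sub ?eqmx_opp ?eW.
(* For [x > 0] the increment [f (x + k) - f x] is the constant [- e 1 - f (- k)]; this slope makes
   [h] below [k]-periodic there. *)
pose A := k%:~R^-1 *: (- e 1 - f (- k)).
have sA : A^T = A by rewrite linearZ /= linearB linearN /= (defect_sym _ _ qf) qf.1.
have kA : k%:~R *: A = - e 1 - f (- k) by apply: scale_int_inv; lia.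
have AW : (A <= W)%MS by rewrite scalemx_sub // -opprD eqmx_opp eW.
exists A; split=> //.
pose h x := f x - x%:~R *: A.
have hk x : 0 < x -> h (x + k) = h x.
  move=> x0; rewrite /h intrD scalerDl kA -(e1 x x0) eE; mxring.
have hkn x (j : nat) : 0 < x -> h (x + j%:Z * k) = h x.
  move=> x0; elim: j => [|j IHj]; first by rewrite mul0r addr0.
  by rewrite -IHj -(hk (x + j%:Z * k)); [congr h; lia | nia].
(* The shift by [k] keeps the argument positive when the residue is 0. *)
pose F x := h ((x %% k)%Z + k).
apply: (@half_line_rank2 h F k W) => //.
- exact: sym_quasihom_sub_linear.
- by move=> x j; rewrite /F (addrC x) modzMDl.
- move=> x x0; rewrite -hk // /F.
  have -> : x + k = (x %% k)%Z + k + `|(x %/ k)%Z|%N%:Z * k.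
    rewrite gez0_abs; last by rewrite divz_ge0 //; lia.
    by have := divz_eq x k; lia.
  by apply: hkn; lia.
move=> x; rewrite /F /h addmx_sub ?eqmx_opp ?(scalemx_sub _ AW) ?fW //; lia.
Qed.

Lemma exit_approx f m W :
  sym_quasihom f -> f 1 = 0 -> 1 < m -> (\rank W <= 2)%N ->
  (forall x, 0 < x < m -> (f x <= W)%MS) -> ~~ (f m <= W)%MS ->
  (forall P, (\rank P <= 1)%N -> ~ forall x, 0 < x < m -> (f x <= P)%MS) ->
  exists A, A^T = A /\ forall x, (\rank (f x - x%:~R *: A)%R <= 2)%N.
Proof.
move=> qf f1 m1 rW fW nmW spanW.
pose e x := defect f x (m - x).
have eE x : e x = f m - f x - f (m - x) by rewrite /e /defect addrCA subrr addr0.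
have fxW x : 0 < x < m -> ((f x + f (m - x))%R <= W)%MS.
  by move=> xm; rewrite addmx_sub ?fW //; lia.
have neW x : 0 < x < m -> ~~ (e x <= W)%MS.
  move=> xm; apply: contra nmW => exW.
  have -> : f m = e x + (f x + f (m - x)) by rewrite eE; mxring.
  by rewrite addmx_sub ?fxW.
have e1 x : 0 < x < m -> e x = e 1.
  move=> xm; apply: (sym_rank1_eq_mod (W := W)); rewrite ?defect_sym ?qf.2 ?neW //.
  have -> : e x - e 1 = (f 1 + f (m - 1)) - (f x + f (m - x)) by rewrite !eE; mxring.
  by rewrite addmx_sub ?eqmx_opp ?fxW //; lia.
(* This slope turns the constant value of [f x + f (m - x)] into 0. *)
pose A := m%:~R^-1 *: (f m - e 1).
have sA : A^T = A by rewrite linearZ /= linearB /= (defect_sym _ _ qf) qf.1.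
have mA : m%:~R *: A = f m - e 1 by apply: scale_int_inv; lia.
have AW : (A <= W)%MS.
  have -> : A = m%:~R^-1 *: (f 1 + f (m - 1)).
    by congr (_ *: _); rewrite eE; mxring.
  by rewrite scalemx_sub ?fxW //; lia.
exists A; split=> //.
pose h x := f x - x%:~R *: A.
have hW x : 0 < x < m -> (h x <= W)%MS.
  by move=> xm; rewrite addmx_sub ?eqmx_opp ?(scalemx_sub _ AW) ?fW.
have hodd x : 0 < x < m -> h (m - x) = - h x.
  move=> xm; have := mA; rewrite -(e1 _ xm) eE => mA'.
  by rewrite /h intrB scalerBl mA'; mxring.
have hm : h m = e 1 by rewrite /h mA; mxring.
(* Oddness forces 0 at multiples of [m], whereas [h 0] may be nonzero. *)
pose F x := if (x %% m)%Z == 0 then 0 else h (x %% m)%Z.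
have Fper x k : F (x + k * m) = F x by rewrite /F (addrC x) modzMDl.
have F0 : F 0 = 0 by rewrite /F mod0z.
have hF x : 0 < x < m -> h x = F x.
  by move=> xm; rewrite /F modz_small ?ifN //; lia.
have m0 : 0 < m by lia.
(* If all defects at 1 lay in a line, telescoping would put every [F x], hence every [f x] with
   [0 < x < m], in that line. *)
have F1 : ~ degenerate F 1.
  case=> P rP F1P; apply: (spanW P rP).
  have FP := periodic_value_sub m0 Fper F1P.
  have FnP (k : nat) : (F k.+1%:Z <= P)%MS.
    elim: k => [|k IHk] //; have -> : k.+2%:Z = 1 + k.+1%:Z by lia.
    have -> : F (1 + k.+1%:Z) = defect F 1 k.+1%:Z + (F 1 + F k.+1%:Z).
      by rewrite /defect; mxring.
    by apply: addmx_sub => //; exact: addmx_sub.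
  have hP x : 0 < x < m -> (h x <= P)%MS.
    move=> xm; rewrite hF //; have -> : x = `|x|.-1.+1%:Z by lia.
    exact: FnP.
  move=> x xm; have -> : f x = h x - x%:~R *: h 1.
    by rewrite /h f1; mxring.
  by rewrite addmx_sub ?eqmx_opp ?scalemx_sub ?hP //; lia.
apply: (@exit_rank2 h F m W) => //; rewrite ?hm ?qf.2 ?neW //; try lia.
- exact: sym_quasihom_sub_linear.
- move=> x; have [r [k [-> rm]]] := int_mod_rep x m0.
  have -> : - (r + k * m) = - r + (- k) * m by ring.
  rewrite !Fper; have [->|r0] := eqVneq r 0; first by rewrite oppr0 F0 oppr0.
  have -> : - r = (m - r) + (- 1) * m by ring.
  by rewrite Fper -!hF ?hodd //; lia.
move=> x; have [r [k [-> rm]]] := int_mod_rep x m0; rewrite Fper.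
have [->|r0] := eqVneq r 0; first by rewrite F0 sub0mx.
by rewrite -hF ?hW //; lia.
Qed.

End QuasiHom.

(** * The two cases, according to the growth of the span of the values *)

Lemma bounded_nat_max (u : nat -> nat) (B : nat) :
  (forall k, u k <= B)%N -> exists k, forall j, (u j <= u k)%N.
Proof.
elim: B => [|B IH] uB; first by exists 0%N => j; apply: leq_trans (uB j) _.
case: (classic (exists k, u k = B.+1)) => [[k uk] | nB]; first by exists k; rewrite uk.
apply: IH => k; have := uB k; rewrite leq_eqVlt => /orP[/eqP uk|//].
by case: nB; exists k.
Qed.

Theorem theorem1p5 (K : fieldType) (n : nat) (f : int -> 'M[K]_n)
    (charK : [pchar K] =i pred0)
    (f_sym : forall x : int, f x \is symmetricmx)
    (f_qhom : forall x y : int, (\rank (f (x + y) - f x - f y)%R <= 1)%N) :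
  exists A : 'M[K]_n,
    A \is symmetricmx /\
    (forall x : int, (\rank (f x - x%:~R *: A)%R <= 2)%N).
Proof.
have qf : sym_quasihom f by split=> // x; exact/symmetricmxP.
pose h x := f x - x%:~R *: f 1.
have qh : sym_quasihom h by apply: sym_quasihom_sub_linear => //; exact: qf.1.
have h1 : h 1 = 0 by rewrite /h scale1r subrr.
suff [A [sA rA]] : exists A : 'M[K]_n, A^T = A /\
    forall x, (\rank (h x - x%:~R *: A)%R <= 2)%N.
  exists (f 1 + A); split=> [|x]; first by apply/symmetricmxP; rewrite linearD /= qf.1 sA.
  by have := rA x; rewrite /h scalerDr opprD addrA.
pose W k := (\sum_(i < k) h i.+1%:Z)%MS.
have WS k : W k.+1 = (W k + h k.+1%:Z)%MS by rewrite /W big_ord_recr.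
have hW (k : nat) x : 0 < x <= k%:Z -> (h x <= W k)%MS.
  elim: k => [|k IHk] xk; first by lia.
  rewrite WS; have [->|xk'] := eqVneq x k.+1%:Z; first exact: addsmxSr.
  by apply: submx_trans (addsmxSl _ _); apply: IHk; lia.
have Wmin (k : nat) (P : 'M[K]_n) :
    (forall x, 0 < x <= k%:Z -> (h x <= P)%MS) -> (W k <= P)%MS.
  by move=> hP; apply/sumsmx_subP => i _; apply: hP; have := ltn_ord i; lia.
(* As [h 1 = 0], consecutive values differ by a single defect of rank at most one. *)
have rWS k : (0 < k)%N -> (\rank (W k.+1) <= (\rank (W k)).+1)%N.
  move=> k0; have : (W k.+1 <= W k + defect h k%:Z 1)%MS.
    rewrite WS addsmx_sub addsmxSl /=.
    have -> : h k.+1%:Z = h k%:Z + defect h k%:Z 1.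
      have -> : k.+1%:Z = k%:Z + 1 by lia.
      by rewrite /defect h1 subr0 [RHS]addrC subrK.
    apply: addmx_sub_adds => //; apply: hW; lia.
  move/mxrankS/leq_trans; apply; apply: leq_trans (mxrank_adds_leqif _ _) _.
  by rewrite -addn1 leq_add2l; exact: qh.2.
case: (classic (exists k, (2 < \rank (W k))%N)) => [ex3 | le2].
  case: (ex_minnP ex3) => m rm3 m_min.
  case: m => [|[|k]] in rm3 m_min *.
  - by rewrite /W big_ord0 mxrank0 in rm3.
  - by rewrite /W big_ord1 h1 mxrank0 in rm3.
  have rk2 : (\rank (W k.+1) <= 2)%N by rewrite leqNgt; apply/negP => /m_min; rewrite ltnn.
  apply: (@exit_approx K charK n h k.+2%:Z (W k.+1)) => //.
  - by move=> x xk; apply: hW; lia.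
  - apply/negP => hk; move: rm3; rewrite ltnNge => /negP; apply.
    by apply: leq_trans rk2; apply: mxrankS; rewrite WS addsmx_sub submx_refl.
  (* The rank jumps by at most one and exceeds 2 at the exit, so it is at least 2 just before, too
     large for [P]. *)
  move=> P rP hP; have /mxrankS : (W k.+1 <= P)%MS by apply: Wmin => x xk; apply: hP; lia.
  by have := rWS k.+1 isT; lia.
have rW2 k : (\rank (W k) <= 2)%N by rewrite leqNgt; apply/negP => rk; apply: le2; exists k.
(* Where the rank is maximal, the increasing spaces [W k] have stabilized and contain all values at
   positive integers. *)
have [k kmax] := bounded_nat_max rW2.
apply: (@half_line_approx K charK n h (W k)) => // x x0.
have sub : (W k <= W (`|x| + k)%N)%MS by apply: Wmin => y yk; apply: hW; lia.
apply: (@submx_trans _ _ _ _ _ _ (W (`|x| + k)%N)); first by apply: hW; lia.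
by have /mxrank_leqif_sup/geq_leqif <- := sub.
Qed.
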